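(* Let $p$ be an odd prime and let $H$ be a proper multiplicative subgroup of $\mathbb{F}_p^*$. If $H=A+B$ for subsets $A,B\subseteq\mathbb{F}_p$ with $|A|,|B|\geq 2$, then $|A|=|B|=2$ and $|H|=4$.
   Context: $\mathbb{F}_p$ is the finite field with $p$ elements and $\mathbb{F}_p^*=\mathbb{F}_p\setminus\{0\}$. A proper multiplicative subgroup is a subgroup $H\leq\mathbb{F}_p^*$ with $H\neq\mathbb{F}_p^*$. The sumset is $A+B=\{a+b: a\in A,\ b\in B\}$. *)

(* Defs.v *)
From mathcomp Require Import all_boot all_order all_fingroup all_algebra.

Set Implicit Arguments.
Unset Strict Implicit.
Unset Printing Implicit Defensive.

Import GRing.Theory.
Local Open Scope ring_scope.

Definition sumset (V : finZmodType) (A B : {set V}) : {set V} :=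
  [set a + b | a in A, b in B].

Definition unit_set (R : finUnitRingType) (H : {set {unit R}}) : {set R} :=
  [set FinRing.uval u | u in H].

(* Main.v *)
Require Import Defs.
From mathcomp Require Import all_boot all_order all_fingroup all_algebra.
From mathcomp Require Import cyclic.
From mathcomp Require Import ring zify.

Set Implicit Arguments.
Unset Strict Implicit.
Unset Printing Implicit Defensive.
Import GRing.Theory.

(** Let m = |A|, n = |B| and d = |H|.  Replacing A by t - A and B by B + t, the
differences b - a run over H, so (b - a)^d = 1; the shift t makes the sum of
A vanish.  Let P and Q be the monic polynomials with simple roots A and B.

Stepanov's method, in the form that Hanson and Petridis gave it, bounds m n.
There are weights c_a with sum c_a a^j = 0 for j < m - 1 and nonzero for
j = m - 1.  The polynomial f = sum c_a (X - a)^(d+m-1) - 1 (suitably scaled)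
has degree at most d, and because (b - a)^d = 1 it vanishes to order m at each
b in B.  It is not zero, because 2 d < p keeps the binomial coefficients
invertible.  Hence m n <= d ([stepanov_bound]), while d <= m n since
H = A + B; so d = m n, every element of H is a sum in one way only, and
f = k Q^m for some constant k.

This equality is what makes the problem rigid.  The Taylor coefficients of f
at b are moments sum c_a (b - a)^(-r), which are rational functions of the
derivatives of P at b.  Comparing the coefficients of order m + 1 and m + 2
with those of k Q^m gives two relations between the derivatives of P and Q at
each root of Q ([stepanov_local]), and exchanging A and B gives the same
relations at each root of P.

A bilinear combination of the products P^(i) Q^(j) with i + j >= 1 has degree
less than m + n.  If it vanishes at all the roots of P Q, it is zero
([eq0_of_roots]).  The relation of order m + 1 so becomes the identity
m(m+1) P Q'' + n(n+1) P'' Q = 2(d-1) P' Q' ([second_order_identity]).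
Let k be the first positive index at which X^(m-k) in P or X^(n-k) in Q has a
nonzero coefficient.  The power sums of H of exponent k < d vanish, which
links the two coefficients; together with the coefficient of X^(m+n-k-2) in
the identity this forces m = n and k even ([equal_sizes]).

For m = n the identity is the apolarity m (P Q'' + P'' Q) = 2(m-1) P' Q'.
Combined with the relation of order m + 2 it fixes P P'' : P'^2 at the roots
of Q, and symmetrically for Q at the roots of P.  Then the three products
P Q''', P' Q'', P'' Q' satisfy at each root of Q one more linear relation,
which is antisymmetric, and so is an identity.  Differentiating it leads in
the same way to an identity between P' Q''' + P''' Q' and P'' Q''.  Its
leading coefficient is a nonzero multiple of (m - 2)(3 m^2 + 4 m - 1), so
m = 2 or p divides 3 m^2 + 4 m - 1 ([size2_or_even]).

In the second case the antisymmetric identity degenerates to P' Q'' = P'' Q',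
which forces k = m, so m is even.  If m >= 4, then p > 2 m^2 leaves only
p = 3 m^2 + 4 m - 1; but m^2 = d divides p - 1, so m divides 2
([exceptional_prime]).  Hence m = n = 2 and d = 4. *)

(** * Elimination at a single root *)

Section Pointwise.
Local Open Scope ring_scope.

(** Certificates for ideal membership: an equation that follows linearly from
others is checked by expanding one polynomial identity.  The coefficients in
the applications below were found by elimination. *)
Lemma lincomb1 (R : comRingType) (c1 l1 r1 l r : R) :
  l1 = r1 -> l - r = c1 * (l1 - r1) -> l = r.
Proof. by move=> -> /eqP; rewrite subrr mulr0 subr_eq0 => /eqP. Qed.

Lemma lincomb2 (R : comRingType) (c1 c2 l1 r1 l2 r2 l r : R) :
  l1 = r1 -> l2 = r2 -> l - r = c1 * (l1 - r1) + c2 * (l2 - r2) -> l = r.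
Proof. by move=> -> /(@lincomb1 _ c2)L; rewrite subrr mulr0 add0r => /L. Qed.

Lemma lincomb3 (R : comRingType) (c1 c2 c3 l1 r1 l2 r2 l3 r3 l r : R) :
  l1 = r1 -> l2 = r2 -> l3 = r3 ->
  l - r = c1 * (l1 - r1) + c2 * (l2 - r2) + c3 * (l3 - r3) -> l = r.
Proof.
by move=> -> /(@lincomb2 _ c2 c3)L; rewrite subrr mulr0 add0r => /L{}L /L.
Qed.

Variable F : fieldType.
Implicit Types x : F.

(** In this section x stands for m = n, and A0, A1, ... and B0, B1, ... for the
successive derivatives of P and Q at a root of Q, so that B0 = 0.  The
polynomials in x are the coefficients that come out of the elimination;
a name such as coefA1B2 refers to the product that the value multiplies. *)
Definition ratio_poly x : F := 3 * x ^+ 3 - 2 * x ^+ 2 - 6 * x + 2.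
Definition jet_poly x : F := 3 * x ^+ 3 - 8 * x ^+ 2 - 11 * x + 4.
Definition exceptional_poly x : F := 3 * x ^+ 2 + 4 * x - 1.
Definition coefAB3 x : F := - x * exceptional_poly x.
Definition coefA1B2 x : F := 3 * ((x - 2) * exceptional_poly x + 4 * x).
Definition coefA1B3 x : F := 2 * (x - 1) * jet_poly x * (ratio_poly x + 3 * x).
Definition coefA2B2 x : F :=
  - (x - 2) * (3 * jet_poly x * (ratio_poly x + x)
               + (ratio_poly x + 3 * x) * (jet_poly x + 6 * x)).

Section At.
Variables (x A0 A1 A2 B1 B2 B3 : F).
Hypotheses (x_neq0 : x != 0) (A0_neq0 : A0 != 0) (B1_neq0 : B1 != 0).
Hypothesis two_neq0 : (2 : F) != 0.
Hypothesis S : x * (A0 * B2) = 2 * (x - 1) * (A1 * B1).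
Hypothesis S' : x * (A0 * B3) = (x - 2) * (A1 * B2 + A2 * B1).

(** S and S' are the apolarity relation and its first derivative.  They express
B2 and B3 through A0, A1, A2 and B1; substituted in the relation of
order m + 2, they leave a relation in which B1 cancels. *)
Lemma ratio_at : x + 1 != 0 ->
  6 * (x ^+ 2 - 1) * (x ^+ 2 - 2) * ((2 * A1 ^+ 2 - A0 * A2) * B1) =
    3 * (x + 2) * (x - 1) * (x ^+ 2 - 1) * (A0 * A1 * B2)
    + 2 * x * (x + 1) * (x + 2) * (A0 ^+ 2 * B3) ->
  x * ratio_poly x * (A0 * A2) = (x - 1) * (ratio_poly x + 3 * x) * A1 ^+ 2.
Proof.
move=> x1_neq0 L2.
have nz : 2 * (x + 1) * B1 != 0 by rewrite !mulf_neq0.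
apply: (mulfI nz); apply: (lincomb3 (c1 := - x) (c2 := - 2 * x * (x + 1) * (x + 2) * A0)
  (c3 := - A1 * (3 * (x + 2) * (x - 1) * (x ^+ 2 - 1) + 2 * (x + 1) * (x ^+ 2 - 4))) L2 S' S).
rewrite /ratio_poly; ring.
Qed.

Hypothesis T : x * ratio_poly x * (A0 * A2) = (x - 1) * (ratio_poly x + 3 * x) * A1 ^+ 2.

(** The ratio of the two coefficients is chosen so that substituting for B2 and
B3 turns the left side into a multiple of the relation T. *)
Lemma third_order_at : coefAB3 x * (A0 * B3) + coefA1B2 x * (A1 * B2 - A2 * B1) = 0.
Proof.
have nz : x ^+ 2 * A0 != 0 by rewrite !mulf_neq0.
apply: (mulfI nz); apply: (lincomb3 (c1 := coefAB3 x * x * A0)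
  (c2 := (coefAB3 x * (x - 2) + x * coefA1B2 x) * A1) (c3 := - 4 * x * B1) S' S T).
rewrite /coefAB3 /coefA1B2 /exceptional_poly /ratio_poly; ring.
Qed.

(** Eliminating B4 gives the equation P6 for A3.  By P6, P7 and P8 the products
jet_poly * A3 * B1, A1 * B3 and A2 * B2 are then multiples of A1 ^ 3 * B1, which
makes the two symmetric products proportional.  The factor jet_poly in
[coefA1B3] avoids a division by it. *)
Lemma fourth_order_at (A3 B4 : F) : ratio_poly x != 0 ->
  x * (A0 * B4) = - 2 * (A1 * B3 + A3 * B1) + 2 * (x - 2) * (A2 * B2) ->
  coefAB3 x * (A0 * B4) + (coefAB3 x + coefA1B2 x) * (A1 * B3 - A3 * B1) = 0 ->
  coefA1B3 x * (A1 * B3 + A3 * B1) + coefA2B2 x * (A2 * B2) = 0.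
Proof.
move=> X_neq0 S'' V'.
have P6 : jet_poly x * (A3 * B1) = (ratio_poly x + 3 * x) * (A1 * B3)
    - (x - 2) * exceptional_poly x * (A2 * B2).
  apply: (mulfI (mulf_neq0 two_neq0 x_neq0)).
  apply: (lincomb2 (c1 := coefAB3 x) (c2 := - x) S'' V').
  rewrite /coefAB3 /coefA1B2 /exceptional_poly /ratio_poly /jet_poly; ring.
have P7 : ratio_poly x * x ^+ 2 * A0 ^+ 2 * (A1 * B3) =
    3 * (x - 1) * (x - 2) * (ratio_poly x + x) * (A1 ^+ 3 * B1).
  apply: (lincomb3 (c1 := ratio_poly x * x * A0 * A1) (c2 := ratio_poly x * (x - 2) * A1 ^+ 2)
    (c3 := (x - 2) * A1 * B1) S' S T); ring.
have P8 : ratio_poly x * x ^+ 2 * A0 ^+ 2 * (A2 * B2) =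
    2 * (x - 1) ^+ 2 * (ratio_poly x + 3 * x) * (A1 ^+ 3 * B1).
  apply: (lincomb2 (c1 := ratio_poly x * x * A0 * A2) (c2 := 2 * (x - 1) * A1 * B1) S T); ring.
have nz : ratio_poly x * x ^+ 2 * A0 ^+ 2 != 0 by rewrite !mulf_neq0.
apply: (mulfI nz); apply: (lincomb3
  (c1 := 2 * (x - 1) * (ratio_poly x + 3 * x) * (ratio_poly x * x ^+ 2 * A0 ^+ 2))
  (c2 := coefA1B3 x + 2 * (x - 1) * (ratio_poly x + 3 * x) ^+ 2)
  (c3 := coefA2B2 x
         - 2 * (x - 1) * (x - 2) * (ratio_poly x + 3 * x) * exceptional_poly x)
  P6 P7 P8).
rewrite /coefA1B3 /coefA2B2 /exceptional_poly /ratio_poly /jet_poly; ring.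
Qed.
End At.

(** The falling factorials of m on the left are the leading coefficients of
derivatives, so this is the top coefficient of the fourth order form. *)
Lemma fourth_order_lead x :
  coefA1B3 x * (2 * (x * (x * (x - 1) * (x - 2)))) + coefA2B2 x * (x * (x - 1)) ^+ 2
  = - 12 * x ^+ 3 * (x - 1) ^+ 2 * (x - 2) * exceptional_poly x.
Proof. rewrite /coefA1B3 /coefA2B2 /exceptional_poly /ratio_poly /jet_poly; ring. Qed.
End Pointwise.

(** * Stepanov's method for a set of differences *)

Section Stepanov.
Local Open Scope ring_scope.
Variable F : fieldType.
Implicit Types (s A B : seq F) (f g P Q : {poly F}).

Definition root_poly s : {poly F} := \prod_(a <- s) ('X - a%:P).

Lemma size_root_poly s : size (root_poly s) = (size s).+1.
Proof. exact: size_prod_XsubC. Qed.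

Lemma root_poly_lead s : (root_poly s)`_(size s) = 1.
Proof.
have := monicP (monic_prod_XsubC s xpredT id).
by rewrite /lead_coef size_prod_XsubC.
Qed.

Lemma root_polyP s a : a \in s -> (root_poly s).[a] = 0.
Proof. by move=> sa; apply/eqP; rewrite -[_ == 0]/(root _ _) root_prod_XsubC. Qed.

Lemma root_poly_neq0 s b : b \notin s -> (root_poly s).[b] != 0.
Proof. by rewrite -[_ == 0]/(root _ _) root_prod_XsubC. Qed.

(** By Lagrange interpolation every coefficient of a polynomial of degree less
than [size s] is a linear form in its values on s; this is the form that reads
the top coefficient. *)
Lemma top_coef_functional s : uniq s -> exists c : F -> F,
  forall j, (j < size s)%N ->
    \sum_(a <- s) c a * a ^+ j = (j.+1 == size s)%:R.
Proof.
move=> us; pose w a : {poly F} := root_poly (rem a s).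
have wE a b : a \in s -> b \in s -> ((w a).[b] == 0) = (b != a).
  move=> sa sb; rewrite -[_ == 0]/(root _ _) root_prod_XsubC mem_rem_uniq //.
  by rewrite !inE sb andbT.
have szw a : a \in s -> size (w a) = size s.
  move=> sa; rewrite size_prod_XsubC size_rem //.
  by case: (s) sa.
have monw a : w a \is monic by apply: monic_prod_XsubC.
(* g is X^j minus its interpolation polynomial on s. *)
exists (fun a => (w a).[a]^-1) => j ltj.
pose g : {poly F} := 'X^j - \sum_(a <- s) ((w a).[a]^-1 * a ^+ j) *: w a.
suff g0 : g = 0.
  have /esym := congr1 (fun g : {poly F} => g`_(size s).-1) g0.
  rewrite coef0 coefB coefXn coef_sum => /esym/eqP; rewrite subr_eq0 => /eqP.
  rewrite eq_sym -eqSS prednK; last by apply: leq_ltn_trans ltj.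
  rewrite eq_sym => ->; rewrite !big_seq; apply: eq_bigr => a sa.
  by rewrite coefZ -(szw a sa) -[X in _ = _ * X]/(lead_coef _) (monicP (monw a)) mulr1.
apply: (@roots_geq_poly_eq0 _ g s) => //.
  apply/allP => b sb; rewrite /root /g !hornerE horner_sum subr_eq0.
  rewrite (bigD1_seq b) //= big_seq_cond big1 ?addr0; last first.
    move=> a /andP[sa ab]; rewrite hornerZ.
    by have /eqP-> : (w a).[b] == 0; rewrite ?mulr0 // wE // eq_sym.
  by rewrite hornerZ mulrAC mulVf ?mul1r // wE ?eqxx.
rewrite (leq_trans (size_polyD _ _)) // geq_max size_polyXn ltj size_polyN /=.
rewrite big_seq; elim/big_rec: _ => [|a g' sa IH]; first by rewrite size_poly0.
rewrite (leq_trans (size_polyD _ _)) // geq_max IH andbT.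
by rewrite (leq_trans (size_scale_leq _ _)) // szw.
Qed.

Lemma coef_shift_XsubC_exp (a b : F) N j :
  ((('X - a%:P) ^+ N) \Po ('X + b%:P))`_j = (b - a) ^+ (N - j) *+ 'C(N, j).
Proof.
have -> : (('X - a%:P) ^+ N) \Po ('X + b%:P) = ((b - a)%:P + 'X) ^+ N.
  rewrite rmorphXn /= comp_polyB comp_polyX comp_polyC polyCB; congr (_ ^+ _).
  by ring.
rewrite exprDn coef_sum (eq_bigr (fun i : 'I_N.+1 =>
    if (i == j :> nat) then (b - a) ^+ (N - j) *+ 'C(N, j) else 0)); last first.
  move=> i _; rewrite coefMn -polyC_exp coefCM coefXn eq_sym.
  by case: eqP => [->|_]; rewrite ?mulr1 ?mulr0 ?mul0rn.
case: (ltnP j N.+1) => jN.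
  by rewrite -big_mkcond /= (big_pred1 (Ordinal jN)).
rewrite big1 ?bin_small // => i _; case: eqP => //.
Qed.

Lemma shift_vanish_dvdp f b m :
  (forall j, (j < m)%N -> (f \Po ('X + b%:P))`_j = 0) ->
  ('X - b%:P) ^+ m %| f.
Proof.
move=> f0; set g := f \Po _ in f0.
have fE : f = g \Po ('X - b%:P) by rewrite /g comp_polyXaddC_K.
rewrite fE -(poly_take_drop m g) comp_polyD.
have -> : take_poly m g = 0.
  by apply/polyP => j; rewrite coef_take_poly coef0; case: ifP => // /f0.
by rewrite comp_poly0 add0r comp_polyM rmorphXn /= comp_polyX dvdp_mull.
Qed.

Lemma root_poly_exp_dvdp s f m : uniq s ->
  (forall b, b \in s -> ('X - b%:P) ^+ m %| f) -> root_poly s ^+ m %| f.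
Proof.
rewrite /root_poly; elim: s => [|b s IH] /=; first by rewrite big_nil expr1n dvd1p.
case/andP=> bs us fb; rewrite big_cons exprMn Gauss_dvdp.
  rewrite fb ?mem_head //= IH // => a sa; apply: fb.
  by rewrite inE sa orbT.
rewrite coprimep_expl // coprimep_expr // coprimep_sym coprimep_XsubC.
by rewrite root_prod_XsubC.
Qed.

Lemma natr_fact_neq0 p N : (forall i, (0 < i < p)%N -> i%:R != 0 :> F) ->
  (N < p)%N -> N`!%:R != 0 :> F.
Proof.
move=> natF; elim: N => [|N IH] ltNp; first by rewrite oner_eq0.
by rewrite factS natrM mulf_neq0 ?IH ?natF // ltnW.
Qed.

Lemma natr_bin_neq0 p N k : (forall i, (0 < i < p)%N -> i%:R != 0 :> F) ->
  (k <= N < p)%N -> 'C(N, k)%:R != 0 :> F.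
Proof.
move=> natF /andP[lekN ltNp]; have := natr_fact_neq0 natF ltNp.
by rewrite -(bin_fact lekN) natrM mulf_eq0 => /norP[].
Qed.

Lemma taylor_coef f b j :
  (f \Po ('X + b%:P))`_j *+ j`! = (f^`(j)).[b].
Proof.
have -> : (f^`(j)).[b] = ((f \Po ('X + b%:P))^`(j))`_0.
  suff -> : (f \Po ('X + b%:P))^`(j) = f^`(j) \Po ('X + b%:P).
    by rewrite -horner_coef0 horner_comp !hornerE.
  elim: j => // j IH; rewrite !derivnS IH deriv_comp derivD derivX derivC.
  by rewrite addr0 mulr1.
by rewrite coef_derivn addn0 ffactnn.
Qed.

Lemma shift_root_poly_coef_monic s b : (root_poly s \Po ('X + b%:P))`_(size s) = 1.
Proof.
have sz : size (root_poly s \Po ('X + b%:P)) = (size s).+1.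
  by rewrite size_comp_poly2 ?size_XaddC // size_prod_XsubC.
have := @lead_coef_comp _ (root_poly s) ('X + b%:P).
rewrite /lead_coef sz /= size_XaddC => -> //.
rewrite -lead_coefE (monicP (monic_prod_XsubC _ _ _)).
by rewrite coefD coefX coefC addr0 expr1n mulr1.
Qed.

(** Here x is m, the D_i are d - i, the M_i are the moments of exponent d - i,
the C_i are the binomial coefficients of d + m - 1 over m + i, and the a_i and
b_i are Taylor coefficients.  The hypotheses on b are the two lowest
coefficients of the equation g' h = m h' g for g = k h^m, where X h is Q shifted
to the root; the hypotheses on a eliminate the moments. *)
Lemma taylor_elimination (x D1 D2 M1 M2 M3 C0 C1 C2 a0 a1 a2 b1 b2 b3 : F) :
  M1 != 0 -> C0 != 0 ->
  C1 * (x + 1) = D1 * C0 -> C2 * (x + 2) = D2 * C1 ->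
  M2 * C1 * b1 = b2 * (M1 * C0) * x ->
  M2 * C1 * b2 + M3 * C2 * 2 * b1
    = (b2 * (M2 * C1) + b3 * 2 * (M1 * C0)) * x ->
  a0 * M2 = a1 * M1 -> a0 * M3 = a1 * M2 - a2 * M1 ->
  x * (x + 1) * (a0 * b2) = D1 * (a1 * b1) /\
  2 * D1 * D2 * ((a1 ^+ 2 - a0 * a2) * b1)
    = (x + 2) * (x - 1) * D1 * (a0 * a1 * b2)
      + 2 * x * (x + 1) * (x + 2) * (a0 ^+ 2 * b3).
Proof.
move=> M1_neq0 C0_neq0 q1 q2 e0 e1 q3 q4.
have sub0 (u v : F) : u = v -> u - v = 0 by move->; rewrite subrr.
move: q1 q2 e0 e1 q3 q4 => /sub0 q1 /sub0 q2 /sub0 e0 /sub0 e1 /sub0 q3 /sub0 q4.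
have M1C0 : M1 * C0 != 0 by rewrite mulf_neq0.
split; apply: (mulIf M1C0); apply/eqP; rewrite -subr_eq0; apply/eqP.
  transitivity (- (x + 1) * a0 * (M2 * C1 * b1 - b2 * (M1 * C0) * x)
    + a0 * M2 * b1 * (C1 * (x + 1) - D1 * C0) + D1 * C0 * b1 * (a0 * M2 - a1 * M1)).
    by ring.
  by rewrite e0 q1 q3 !mulr0 !addr0.
transitivity ((x + 1) * (x + 2) * a0 ^+ 2 *
    (M2 * C1 * b2 + M3 * C2 * 2 * b1
      - (b2 * (M2 * C1) + b3 * 2 * (M1 * C0)) * x)
  - 2 * b1 * D1 * D2 * C0 *
      (a0 * (a0 * M3 - (a1 * M2 - a2 * M1)) + a1 * (a0 * M2 - a1 * M1))
  - 2 * b1 * a0 ^+ 2 * M3 *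
      ((x + 1) * (C2 * (x + 2) - D2 * C1) + D2 * (C1 * (x + 1) - D1 * C0))
  + (x + 2) * (x - 1) * b2 *
      (a0 ^+ 2 * M2 * (C1 * (x + 1) - D1 * C0) + D1 * C0 * a0 * (a0 * M2 - a1 * M1))).
  by ring.
by rewrite e1 q1 q2 q3 q4 !(mulr0, addr0, subr0).
Qed.

(** The right side eps is arbitrary because exchanging A and B turns 1 into
(-1)^d. *)
Section TwoSets.
Variables (A B : seq F) (d p : nat) (eps : F).
Hypotheses (uA : uniq A) (uB : uniq B).
Let m := size A.
Let n := size B.
Hypotheses (m_ge2 : (2 <= m)%N) (B_neq0 : (0 < n)%N) (d_gt0 : (0 < d)%N).
Hypotheses (eps_neq0 : eps != 0) (ltdmp : (d + m <= p)%N).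
Hypothesis (natF : forall i, (0 < i < p)%N -> i%:R != 0 :> F).
Hypothesis (diffAB : forall a b, a \in A -> b \in B -> (b - a) ^+ d = eps).

Let N := (d + m).-1.

Section Weights.
Variable c : F -> F.
Hypothesis cP : forall j, (j < m)%N ->
  \sum_(a <- A) c a * (- a) ^+ j = (j.+1 == m)%:R.

Let mu x e := \sum_(a <- A) c a * (x - a) ^+ e.

(** Expanding (x - a)^e, only the power a^(m-1) has a nonzero weighted sum. *)
Let mu_small x e : (e < m)%N -> mu x e = (e.+1 == m)%:R.
Proof.
move=> ltem; rewrite /mu.
under eq_bigr do rewrite exprDn mulr_sumr.
rewrite exchange_big /= big_ord_recr /= big1 ?add0r => [|i _].
  rewrite subnn binn -cP //; apply: eq_bigr => a _.
  by rewrite expr0 mul1r mulr1n.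
have lti : (i.+1 < m)%N by apply: leq_ltn_trans ltem.
transitivity (x ^+ (e - i) *+ 'C(e, i) * \sum_(a <- A) c a * (- a) ^+ i).
  rewrite mulr_sumr; apply: eq_bigr => a _.
  by rewrite -mulrnAl mulrCA.
by rewrite cP 1?ltnW // ltn_eqF // mulr0.
Qed.

Let mu_d b e : b \in B -> mu b (d + e) = eps * mu b e.
Proof.
move=> Bb; rewrite mulr_sumr; apply: eq_big_seq => a Aa.
by rewrite exprD diffAB // mulrCA.
Qed.

Let f : {poly F} := \sum_(a <- A) c a *: ('X - a%:P) ^+ N - eps%:P.

Let coef_f b j :
  (f \Po ('X + b%:P))`_j = mu b (N - j) *+ 'C(N, j) - (j == 0%N)%:R * eps.
Proof.
rewrite comp_polyB comp_polyC coefB coefC; congr (_ - _); last first.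
  by case: eqP; rewrite ?mul1r ?mul0r.
rewrite rmorph_sum coef_sum -sumrMnl; apply: eq_bigr => a _ /=.
by rewrite comp_polyZ coefZ coef_shift_XsubC_exp mulrnAr.
Qed.

(** Below order m the exponent N - j is at least d, so the factor (b - a)^d
becomes eps and leaves a moment of exponent m - 1 - j, which vanishes unless
j = 0; there the constant eps cancels it. *)
Let f_vanish b : b \in B -> ('X - b%:P) ^+ m %| f.
Proof.
move=> Bb; apply: shift_vanish_dvdp => j ltjm; rewrite coef_f.
have -> : (N - j = d + (m.-1 - j))%N by rewrite /N; lia.
rewrite mu_d // mu_small; last by lia.
have -> : ((m.-1 - j).+1 == m) = (j == 0%N) by apply/eqP/eqP; lia.
by case: eqP => [->|_]; rewrite ?bin0 ?mulr1 ?mul1r ?subrr // mulr0 mul0rn mul0r subr0.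
Qed.

(** The coefficients above degree d are moments at 0 of exponent less than
m - 1. *)
Let size_f : (size f <= d.+1)%N.
Proof.
apply/leq_sizeP => j ltdj.
have -> : f`_j = (f \Po ('X + 0%:P))`_j by rewrite addr0 comp_polyXr.
rewrite coef_f mu_small; last by rewrite /N; lia.
have -> : ((N - j).+1 == m) = false by apply/eqP; rewrite /N; lia.
have -> : (j == 0%N) = false by lia.
by rewrite mul0rn mul0r subr0.
Qed.

Section AtPoint.
Variable b : F.
Hypothesis Bb : b \in B.
Let At : {poly F} := root_poly A \Po ('X + b%:P).
Let Bt : {poly F} := root_poly B \Po ('X + b%:P).

Let size_At : size At = m.+1.
Proof. by rewrite size_comp_poly2 ?size_XaddC // size_prod_XsubC. Qed.

(** The polynomial At vanishes at -(b - a); multiplying this equation by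
c_a (b - a)^(d - r) and summing over a relates consecutive moments.  The terms
with l >= r have exponent at least d, and by [mu_small] at most one of them
survives. *)
Let moment_rec r : (0 < r <= d)%N ->
  \sum_(l < r) At`_l * (-1) ^+ l * mu b (d - r + l)
    = - ((-1) ^+ (r + m.-1) * eps * At`_(r + m.-1)).
Proof.
move=> /andP[r_gt0 lerd]; apply/eqP; rewrite -addr_eq0; apply/eqP.
have root_sum : \sum_(l < r + m.+1) At`_l * (-1) ^+ l * mu b (d - r + l) = 0.
  transitivity (\sum_(a <- A) c a * (b - a) ^+ (d - r) * At.[- (b - a)]).
    rewrite /mu; under eq_bigr do rewrite mulr_sumr.
    rewrite exchange_big; apply: eq_bigr => a _ /=.
    rewrite (@horner_coef_wide _ (r + m.+1)) ?size_At ?leq_addl //.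
    rewrite mulr_sumr; apply: eq_bigr => l _.
    rewrite [(- (b - a)) ^+ _]exprNn exprD.
    move: (At`_l) ((b - a) ^+ (d - r)) ((b - a) ^+ l) ((-1) ^+ l) => w x y z; ring.
  rewrite big_seq big1 // => a Aa; rewrite horner_comp !hornerE.
  rewrite opprB subrK; have /eqP-> : root (root_poly A) a.
    by rewrite root_prod_XsubC.
  by rewrite mulr0.
rewrite -[RHS]root_sum big_split_ord /=; congr (_ + _).
have m_gt0 : (0 < m)%N by lia.
rewrite -[in RHS](prednK m_gt0) !big_ord_recr /=.
rewrite [At`_(r + m.-1.+1)]nth_default ?size_At; last by lia.
rewrite !mul0r addr0 big1 => [|l _].
  have -> : (d - r + (r + m.-1) = d + m.-1)%N by lia.
  rewrite mu_d // mu_small ?(prednK m_gt0) // eqxx mulr1 add0r.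
  by rewrite mulrC mulrA.
have -> : (d - r + (r + l) = d + l)%N by lia.
have ltl := ltn_ord l.
rewrite mu_d // mu_small; last by lia.
by have -> : (l.+1 == m) = false; [apply/eqP; lia | rewrite !mulr0].
Qed.

Let At_m : At`_m = 1.
Proof. exact: shift_root_poly_coef_monic. Qed.

Let moment1 : At`_0 * mu b (d - 1) != 0.
Proof.
have := @moment_rec 1; rewrite big_ord1 addn0 expr0 mulr1 => -> //.
have -> : (1 + m.-1 = m)%N by lia.
by rewrite At_m mulr1 oppr_eq0 mulf_neq0 // signr_eq0.
Qed.

Let f_coef_m j : (j < d)%N ->
  (f \Po ('X + b%:P))`_(m + j) = mu b (d - j.+1) *+ 'C(N, m + j).
Proof.
move=> ltjd; rewrite coef_f.
have -> : (N - (m + j) = d - j.+1)%N by rewrite /N; lia.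
have -> : ((m + j)%N == 0%N) = false by rewrite addn_eq0 eqn0Ngt (ltnW m_ge2).
by rewrite mul0r subr0.
Qed.

Let f_neq0 : f != 0.
Proof.
apply/eqP => f0; have := f_coef_m d_gt0.
rewrite f0 comp_poly0 coef0 addn0 => /esym/eqP; apply/negP.
rewrite -mulr_natr mulf_neq0 //; last by apply: (natr_bin_neq0 natF); rewrite /N; lia.
by have := moment1; rewrite mulf_eq0 => /norP[].
Qed.

Let size_Bm : size (root_poly B ^+ m) = (m * n).+1.
Proof.
have Bm_neq0 : root_poly B ^+ m != 0.
  by rewrite expf_neq0 // monic_neq0 // monic_prod_XsubC.
rewrite -[LHS]prednK ?size_poly_gt0 //.
by rewrite size_exp size_prod_XsubC /= mulnC.
Qed.

Let Bm_dvd : root_poly B ^+ m %| f.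
Proof. exact: root_poly_exp_dvdp. Qed.

Lemma stepanov_bound_weights : (m * n <= d)%N.
Proof.
have := dvdp_leq f_neq0 Bm_dvd; rewrite size_Bm => le.
by rewrite -ltnS (leq_trans le).
Qed.

Hypothesis d_ge3 : (3 <= d)%N.

Let moment2 : At`_0 * mu b (d - 2) = At`_1 * mu b (d - 1).
Proof.
have := @moment_rec 2; rewrite [At`_(2 + _)]nth_default; last by rewrite size_At; lia.
rewrite mulr0 oppr0 !big_ord_recr big_ord0 /= => H.
apply/eqP; rewrite -subr_eq0; apply/eqP; rewrite -[RHS]H; last by lia.
have -> : (d - 2 + 1 = d - 1)%N by lia.
by rewrite addn0; ring.
Qed.

Let moment3 :
  At`_0 * mu b (d - 3) = At`_1 * mu b (d - 2) - At`_2 * mu b (d - 1).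
Proof.
have := @moment_rec 3; rewrite [At`_(3 + _)]nth_default; last by rewrite size_At; lia.
rewrite mulr0 oppr0 !big_ord_recr big_ord0 /= => H.
apply/eqP; rewrite -subr_eq0; apply/eqP; rewrite -[RHS]H; last by lia.
have -> : (d - 3 + 1 = d - 2)%N by lia.
have -> : (d - 3 + 2 = d - 1)%N by lia.
by rewrite addn0; ring.
Qed.

Let f_eq_Bm : d = (m * n)%N -> exists k, f = k *: root_poly B ^+ m.
Proof.
move=> dE; have : root_poly B ^+ m %= f.
  rewrite -dvdp_size_eqp // eqn_leq dvdp_leq //=.
  by rewrite size_Bm -dE.
case/eqpP=> [[k1 k2]] /= /andP[k1n k2n] e; exists (k2^-1 * k1).
by rewrite -scalerA e scalerA mulVf ?scale1r.
Qed.

Lemma stepanov_local_weights : d = (m * n)%N ->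
  [/\ (m * m.+1)%:R * (At`_0 * Bt`_2) = d.-1%:R * (At`_1 * Bt`_1) &
    (2 * d.-1 * d.-2)%:R * ((At`_1 ^+ 2 - At`_0 * At`_2) * Bt`_1) =
    (m.+2 * m.-1 * d.-1)%:R * (At`_0 * At`_1 * Bt`_2)
     + (2 * m * m.+1 * m.+2)%:R * (At`_0 ^+ 2 * Bt`_3)].
Proof.
have lemN : (m <= N)%N by rewrite /N; lia.
have ltmN : (m < N)%N by rewrite /N; lia.
have dm1 : (N - m = d.-1)%N by rewrite /N; lia.
have dm2 : (N - m.+1 = d.-2)%N by rewrite /N; lia.
have ltNp : (N < p)%N by rewrite /N; lia.
have d_gt1 : (1 < d)%N by apply: ltnW.
have m_gt0 : (0 < m)%N by lia.
have predm : m.-1%:R = m%:R - 1 :> F by rewrite -subn1 natrB.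
have C0 : 'C(N, m)%:R != 0 :> F by apply: (natr_bin_neq0 natF); rewrite lemN.
have M1 : mu b (d - 1) != 0 by have := moment1; rewrite mulf_eq0 => /norP[].
have bin_step i : (i <= N)%N ->
    'C(N, i.+1)%:R * i.+1%:R = (N - i)%:R * 'C(N, i)%:R :> F.
  by move=> lei; rewrite -!natrM mulnC mul_bin_left mulnC.
have q1 : 'C(N, m.+1)%:R * (m%:R + 1) = d.-1%:R * 'C(N, m)%:R :> F.
  by rewrite natr1 bin_step // dm1.
have q2 : 'C(N, m.+2)%:R * (m%:R + 2) = d.-2%:R * 'C(N, m.+1)%:R :> F.
  by rewrite -natrD addn2 bin_step // dm2.
move=> /f_eq_Bm[k fE].
pose h := drop_poly 1 Bt; pose g := k *: h ^+ m.
have BtE : Bt = h * 'X.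
  rewrite -[LHS](poly_take_drop 1) expr1.
  suff -> : take_poly 1 Bt = 0 by rewrite add0r.
  apply/polyP => -[|j]; rewrite coef_take_poly coef0 //=.
  rewrite -horner_coef0 horner_comp !hornerE.
  by apply/eqP; rewrite -[_ == _]/(root _ _) root_prod_XsubC.
have hE j : h`_j = Bt`_j.+1 by rewrite BtE coefMX.
have gE j : (j < d)%N -> g`_j = mu b (d - j.+1) *+ 'C(N, m + j).
  move=> /f_coef_m <-; rewrite fE comp_polyZ rmorphXn /= -/Bt BtE exprMn scalerAl.
  by rewrite coefMXn ltnNge leq_addr addKn.
have ode : g^`() * h = (h^`() * g) *+ m.
  rewrite /g -mul_polyC derivM derivC mul0r add0r deriv_exp.
  have -> : h ^+ m = h * h ^+ m.-1 by rewrite -exprS prednK.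
  by rewrite mulrnAr mulrnAl; congr (_ *+ _); ring.
have e0 := congr1 (fun q : {poly F} => q`_0) ode.
have e1 := congr1 (fun q : {poly F} => q`_1) ode.
move: e0 e1; rewrite !coefMn !coefM !big_ord_recr !big_ord0 /= !coef_deriv !hE.
rewrite !(subnn 0) !gE // !addn0 !addn1 !addn2 !mulr1n !add0r => e0 e1.
rewrite -!(mulr_natr (mu _ _)) -(mulr_natr _ m) in e0.
rewrite -!(mulr_natr (mu _ _)) -(mulr_natr _ m) -(mulr_natr (_ * _) 2)
  -(mulr_natr Bt`_3) in e1.
have [E1 E2] := taylor_elimination M1 C0 q1 q2 e0 e1 moment2 moment3.
split.
  by rewrite natrM -[m.+1%:R]natr1 E1.
have m2E : m.+2%:R = m%:R + 2 :> F by rewrite -addn2 natrD.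
by rewrite !natrM predm m2E -[m.+1%:R]natr1 E2.
Qed.
End AtPoint.
End Weights.

Let weights : exists c : F -> F, forall j, (j < m)%N ->
  \sum_(a <- A) c a * (- a) ^+ j = (j.+1 == m)%:R.
Proof.
have [] := @top_coef_functional (map -%R A).
  by rewrite map_inj_uniq //; apply: oppr_inj.
move=> c cP; exists (fun a => c (- a)) => j ltjm.
by have := cP j; rewrite size_map big_map; apply.
Qed.

(** The Hanson-Petridis bound for a set of differences inside a coset of the
d-th roots of unity. *)
Lemma stepanov_bound : (m * n <= d)%N.
Proof.
have [b Bb] : exists b, b \in B.
  by move: B_neq0; rewrite /n; case: (B) => // b s _; exists b; rewrite mem_head.
by have [c cP] := weights; exact: (stepanov_bound_weights cP Bb).
Qed.

(** In the extremal case the auxiliary polynomial is a constant times the m-th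
power of the polynomial with roots B.  The two equations compare their Taylor
coefficients at b of order m + 1 and m + 2; the one of order m only fixes the
constant. *)
Lemma stepanov_local b : b \in B -> (3 <= d)%N -> d = (m * n)%N ->
  let PA := root_poly A in let PB := root_poly B in
  (m * m.+1)%:R * (PA.[b] * PB^`()^`().[b]) =
    (2 * d.-1)%:R * (PA^`().[b] * PB^`().[b]) /\
  (6 * d.-1 * d.-2)%:R *
    ((2 * PA^`().[b] ^+ 2 - PA.[b] * PA^`()^`().[b]) * PB^`().[b]) =
    (3 * m.+2 * m.-1 * d.-1)%:R * (PA.[b] * PA^`().[b] * PB^`()^`().[b])
     + (2 * m * m.+1 * m.+2)%:R * (PA.[b] ^+ 2 * PB^`()^`()^`().[b]).
Proof.
move=> Bb d_ge3 dE PA PB; have [c cP] := weights.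
have [E1 E2] := stepanov_local_weights cP Bb d_ge3 dE.
have T0 f : f.[b] = (f \Po ('X + b%:P))`_0 by rewrite -[RHS]mulr1n (taylor_coef f b 0).
have T1 f : f^`().[b] = (f \Po ('X + b%:P))`_1 by rewrite -[RHS]mulr1n (taylor_coef f b 1).
have T2 f : f^`()^`().[b] = (f \Po ('X + b%:P))`_2 *+ 2 by rewrite (taylor_coef f b 2).
have T3 f : f^`()^`()^`().[b] = (f \Po ('X + b%:P))`_3 *+ 6.
  by rewrite (taylor_coef f b 3).
rewrite T3 !T2 !T1 !T0; split.
  transitivity ((m * m.+1)%:R * ((PA \Po ('X + b%:P))`_0 * (PB \Po ('X + b%:P))`_2) *+ 2).
    by rewrite !mulrnAr.
  by rewrite E1 natrM -mulrnAl -mulrA mulr_natl mulrnAl.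
apply/eqP; rewrite -subr_eq0; apply/eqP.
move: E2 => /eqP; rewrite -subr_eq0 => /eqP E2.
rewrite -[RHS](mulr0 6) -[X in _ = _ * X]E2 !natrM; ring.
Qed.

End TwoSets.
End Stepanov.

(** * Coefficients near the top degree *)

Section Coefficients.
Local Open Scope ring_scope.
Variable F : fieldType.
Implicit Types (s A B : seq F) (P Q V : {poly F}).

Lemma natr_ffact2 i : (i ^_ 2)%:R = i%:R * (i%:R - 1) :> F.
Proof.
case: i => [|i]; first by rewrite mul0r.
by rewrite ffactnS /= ffactn1 natrM -[X in _ = _ * (X - 1)]natr1 addrK.
Qed.

Lemma natr_ffact3 i : (i ^_ 3)%:R = i%:R * (i%:R - 1) * (i%:R - 2) :> F.
Proof.
case: i => [|i]; first by rewrite !mul0r.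
rewrite ffactnS /= natrM natr_ffact2 -[X in _ = _ * (X - 1) * (X - 2)]natr1.
by rewrite -mulrA; congr (_ * _); ring.
Qed.

(** This operator multiplies each monomial by a scalar, so that the index of a
coefficient does not move and needs no truncated subtraction. *)
Definition euler r P : {poly F} := 'X^r * P^`(r).

Lemma coef_euler r P i : (euler r P)`_i = (i ^_ r)%:R * P`_i.
Proof.
rewrite coefXnM mulr_natl; case: ltnP => [ltir|leri].
  by rewrite ffact_small.
by rewrite coef_derivn subnKC.
Qed.

(** If P has a gap between the degrees m and m - k, the coefficient of the
product at m + n - k receives only the two extreme contributions. *)
Lemma sparse_coefM P Q m n k : (0 < k <= m)%N -> (k <= n)%N ->
  (size P <= m.+1)%N -> (size Q <= n.+1)%N ->
  (forall i, (0 < i < k)%N -> P`_(m - i) = 0) ->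
  (P * Q)`_(m + n - k) = P`_m * Q`_(n - k) + P`_(m - k) * Q`_n.
Proof.
move=> /andP[k_gt0 lekm] lekn szP szQ gapP; rewrite coefM.
have ltm : (m < (m + n - k).+1)%N by lia.
have ltmk : (m - k < (m + n - k).+1)%N by lia.
rewrite (bigD1 (Ordinal ltm)) //= (bigD1 (Ordinal ltmk)) /=; last first.
  by rewrite -val_eqE /=; lia.
rewrite (_ : m + n - k - m = n - k)%N; last by lia.
rewrite (_ : m + n - k - (m - k) = n)%N; last by lia.
rewrite big1 ?addr0 // => i /andP[]; rewrite -!val_eqE /= => im imk.
have [ltmi|leim] := ltnP m i; first by rewrite nth_default ?mul0r // (leq_trans szP).
have [ltim|lemi] := ltnP i (m - k).
  by rewrite [Q`_ _]nth_default ?mulr0 // (leq_trans szQ) //; lia.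
rewrite (_ : nat_of_ord i = m - (m - i))%N ?gapP ?mul0r //; lia.
Qed.

(** This turns relations that hold at single roots into identities between
polynomials. *)
Lemma eq0_of_roots A B V : uniq (A ++ B) -> (size V <= size A + size B)%N ->
  (forall a, a \in A -> V.[a] = 0) -> (forall b, b \in B -> V.[b] = 0) -> V = 0.
Proof.
move=> uAB szV VA VB; apply: (@roots_geq_poly_eq0 _ _ (A ++ B)) => //.
  by apply/allP => x; rewrite mem_cat => /orP[/VA|/VB] Vx; rewrite /root Vx.
by rewrite size_cat.
Qed.

Lemma size_polyD_le N P Q :
  (size P <= N)%N -> (size Q <= N)%N -> (size (P + Q)%R <= N)%N.
Proof. by move=> szP szQ; rewrite (leq_trans (size_polyD _ _)) // geq_max szP. Qed.

Lemma size_derivn_le P k : (size P^`(k) <= size P - k)%N.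
Proof.
apply/leq_sizeP => l; rewrite leq_subLR => lePl.
by rewrite coef_derivn nth_default ?mul0rn.
Qed.

Lemma size_derivnM_le P Q m n i j : (size P <= m.+1)%N -> (size Q <= n.+1)%N ->
  (0 < i + j)%N -> (size (P^`(i) * Q^`(j))%R <= m + n)%N.
Proof.
move=> szP szQ ij; apply: leq_trans (size_polyMleq _ _) _.
by have := size_derivn_le P i; have := size_derivn_le Q j; lia.
Qed.

Lemma deriv_root_poly s :
  (root_poly s)^`() = \sum_(a <- s) root_poly (rem a s).
Proof.
rewrite /root_poly; elim: s => [|x s IH]; first by rewrite !big_nil derivC.
rewrite big_cons derivM derivXsubC mul1r IH mulr_sumr big_cons /= eqxx.
congr (_ + _); apply: eq_big_seq => a sa /=.
case: eqP => [->|_]; last by rewrite big_cons.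
by rewrite [RHS](perm_big _ (perm_to_rem sa)) big_cons.
Qed.
End Coefficients.

(** * Power sums and apolar pairs *)

Section Decomposition.
Local Open Scope ring_scope.
Variable F : fieldType.
Implicit Types (s A B : seq F) (P Q V : {poly F}).

(** Newton's identity, in the case where the elementary symmetric functions of
orders 1, ..., k - 1 vanish.  The quotient of the polynomial by X - a has top
coefficients 1, a, a^2, ..., and summing the quotients over a gives the
derivative. *)
Lemma gap_power_sum s k : (0 < k <= size s)%N ->
  (forall i, (0 < i < k)%N -> (root_poly s)`_(size s - i) = 0) ->
  \sum_(a <- s) a ^+ k = - (k%:R * (root_poly s)`_(size s - k)).
Proof.
move=> /andP[k_gt0 leks] gap; set m := size s in leks gap *; set P := root_poly s in gap *.
have wE a : a \in s -> P = 'X * root_poly (rem a s) - a%:P * root_poly (rem a s).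
  move=> sa; rewrite -mulrBl /P /root_poly (perm_big _ (perm_to_rem sa)).
  by rewrite big_cons.
have w_top a j : a \in s -> (j < k)%N -> (root_poly (rem a s))`_(m.-1 - j) = a ^+ j.
  move=> sa; elim: j => [|j IH] ltjk.
    by rewrite subn0 -(size_rem sa) root_poly_lead.
  have := congr1 (fun Q : {poly F} => Q`_(m - j.+1)) (wE a sa).
  rewrite gap ?ltjk // coefB coefCM coefXM => /esym/eqP; rewrite subr_eq0.
  rewrite (_ : (m - j.+1 == 0)%N = false); last by apply/eqP; lia.
  rewrite (_ : (m - j.+1).-1 = m.-1 - j.+1)%N; last by lia.
  rewrite (_ : (m - j.+1) = m.-1 - j)%N; last by lia.
  by rewrite IH ?exprS => [/eqP|]; last exact: ltnW.
have : m%:R * P`_(m - k) =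
    (euler 1 P)`_(m - k) - \sum_(a <- s) a ^+ k.
  rewrite /euler expr1 derivn1 deriv_root_poly mulr_sumr coef_sum -sumrB.
  rewrite mulr_natl -[LHS]addr0 -iter_addr -[m]count_predT -big_const_seq.
  apply: eq_big_seq => a sa; rewrite [in LHS](wE a sa) coefB coefCM; congr (_ - _).
  rewrite (_ : m - k = m.-1 - k.-1)%N; last by lia.
  by rewrite w_top ?prednK // -exprS prednK.
rewrite coef_euler ffactn1 natrB // => H.
by apply/eqP; rewrite -subr_eq0; apply/eqP; apply: (lincomb1 (c1 := 1) H); ring.
Qed.

Lemma size_euler_le r P : (size (euler r P) <= size P)%N.
Proof.
by apply/leq_sizeP => i lei; rewrite coef_euler nth_default // mulr0.
Qed.

Lemma gap_coef_euler A B k r t : let m := size A in let n := size B in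
  (0 < k <= m)%N -> (k <= n)%N ->
  (forall i, (0 < i < k)%N -> (root_poly A)`_(m - i) = 0) ->
  (euler r (root_poly A) * euler t (root_poly B))`_(m + n - k)
  = (m ^_ r)%:R * ((n - k) ^_ t)%:R * (root_poly B)`_(n - k)
    + ((m - k) ^_ r)%:R * (n ^_ t)%:R * (root_poly A)`_(m - k).
Proof.
move=> m n lekm lekn gap; rewrite (sparse_coefM lekm lekn); first last.
- by move=> i /gap; rewrite coef_euler => ->; rewrite mulr0.
- by rewrite (leq_trans (size_euler_le _ _)) // size_root_poly.
- by rewrite (leq_trans (size_euler_le _ _)) // size_root_poly.
rewrite !coef_euler !root_poly_lead !mulr1; congr (_ + _); first by rewrite mulrA.
by rewrite mulrAC.
Qed.

Lemma top_coef_euler A B r t : let m := size A in let n := size B in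
  (euler r (root_poly A) * euler t (root_poly B))`_(m + n)
  = (m ^_ r)%:R * (n ^_ t)%:R.
Proof.
move=> m n.
have sz u s : (size (euler u (root_poly s)) <= (size s).+1)%N.
  by rewrite (leq_trans (size_euler_le _ _)) // size_root_poly.
have ltm : (m < (m + n).+1)%N by rewrite ltnS leq_addr.
rewrite coefM (bigD1 (Ordinal ltm)) //= addKn !coef_euler !root_poly_lead !mulr1.
rewrite big1 ?addr0 // => i; rewrite -val_eqE /= => im.
have [ltmi|ltim|/eqP] := ltngtP m i; last by rewrite eq_sym (negbTE im).
  by rewrite nth_default ?mul0r // (leq_trans (sz _ _)).
rewrite [(euler t _)`_ _]nth_default ?mulr0 // (leq_trans (sz _ _)) // -/n.
by move: ltim; clear; lia.
Qed.

(** Otherwise the polynomial is a power of X, whose only root is 0. *)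
Lemma exists_lower_coef s : uniq s -> (2 <= size s)%N ->
  exists2 k, (0 < k <= size s)%N & (root_poly s)`_(size s - k) != 0.
Proof.
move=> us s_ge2; set P := root_poly s.
have [/hasP[k]|/hasPn noc] := boolP (has (fun k => P`_(size s - k) != 0) (iota 1 (size s))).
  by rewrite mem_iota => k1 Pk; exists k => //; lia.
have PE : P = 'X^(size s).
  apply/polyP => i; rewrite coefXn; case: ltngtP => [lti|gti|->].
  - apply/eqP/negPn/negP => Pi; have := noc (size s - i)%N.
    by rewrite mem_iota subKn ?(ltnW lti) // Pi => /implyP; lia.
  - by rewrite nth_default // size_root_poly.
  - exact: root_poly_lead.
have s0 a : a \in s -> a = 0.
  move=> /root_polyP; rewrite -/P PE hornerXn => /eqP.
  by rewrite expf_eq0 => /andP[_ /eqP].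
case: (s) us s_ge2 s0 => [|a [|b t]] //= /andP[+ _] _ s0.
have sb : b \in a :: b :: t by rewrite !inE eqxx orbT.
by rewrite (s0 a (mem_head _ _)) (s0 b sb) mem_head.
Qed.

(** In the binomial expansion all the mixed terms contain a vanishing power sum
of A. *)
Lemma difference_power_sum A B k : (0 < k)%N ->
  (forall i, (0 < i < k)%N -> \sum_(a <- A) a ^+ i = 0) ->
  \sum_(a <- A) \sum_(b <- B) (b - a) ^+ k =
  (size A)%:R * \sum_(b <- B) b ^+ k + (-1) ^+ k * (size B)%:R * \sum_(a <- A) a ^+ k.
Proof.
case: k => // k _ gap.
have termE i : \sum_(a <- A) \sum_(b <- B) b ^+ (k.+1 - i) * (- a) ^+ i *+ 'C(k.+1, i)
    = (-1) ^+ i * (\sum_(a <- A) a ^+ i) * (\sum_(b <- B) b ^+ (k.+1 - i)) *+ 'C(k.+1, i).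
  rewrite -mulrA mulr_suml mulr_sumr -sumrMnl; apply: eq_bigr => a _.
  rewrite mulr_sumr mulr_sumr -sumrMnl; apply: eq_bigr => b _.
  by rewrite [(- a) ^+ _]exprNn; congr (_ *+ _); rewrite mulrC mulrA.
transitivity (\sum_(i < k.+2) \sum_(a <- A) \sum_(b <- B)
    b ^+ (k.+1 - i) * (- a) ^+ i *+ 'C(k.+1, i)).
  rewrite [RHS]exchange_big; apply: eq_bigr => a _; rewrite [RHS]exchange_big.
  by apply: eq_bigr => b _; rewrite exprDn.
have sum0 s : \sum_(a <- s) a ^+ 0 = (size s)%:R.
  under eq_bigr do rewrite expr0.
  by rewrite big_const_seq count_predT iter_addr addr0.
rewrite big_ord_recl big_ord_recr /= [X in _ + (X + _)]big1 ?add0r => [|i _].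
  rewrite !termE /bump add1n bin0 binn !mulr1n subn0 subnn expr0 mul1r.
  by rewrite !sum0 mulrAC.
by rewrite termE gap ?mulr0 ?mul0r ?mul0rn //= /bump /= add1n ltnS ltn_ord.
Qed.

(** These are the values at a root of Q of the apolarity relation and of its
first two derivatives; each one expresses the highest derivative of Q. *)
Lemma apolar_local P Q (x t : F) :
  x *: (P * Q^`()^`() + P^`()^`() * Q) = (2 * (x - 1)) *: (P^`() * Q^`()) ->
  Q.[t] = 0 ->
  [/\ x * (P.[t] * Q^`()^`().[t]) = 2 * (x - 1) * (P^`().[t] * Q^`().[t]),
   x * (P.[t] * Q^`()^`()^`().[t]) =
     (x - 2) * (P^`().[t] * Q^`()^`().[t] + P^`()^`().[t] * Q^`().[t]) &
   x * (P.[t] * Q^`()^`()^`()^`().[t]) =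
     - 2 * (P^`().[t] * Q^`()^`()^`().[t] + P^`()^`()^`().[t] * Q^`().[t])
     + 2 * (x - 2) * (P^`()^`().[t] * Q^`()^`().[t])].
Proof.
move=> apo Qt.
have apo1 : x *: (P * Q^`()^`()^`() + P^`()^`()^`() * Q)
    = (x - 2) *: (P^`() * Q^`()^`() + P^`()^`() * Q^`()).
  have := congr1 (@deriv _) apo; rewrite !(derivZ, derivD, derivM) => H.
  rewrite -!mul_polyC in H *; apply: (lincomb1 (c1 := 1) H).
  by rewrite !(rmorphD, rmorphM, rmorphN, rmorph1, rmorph_nat) /=; ring.
have apo2 : x *: (P * Q^`()^`()^`()^`() + P^`()^`()^`()^`() * Q)
    = (-2) *: (P^`() * Q^`()^`()^`() + P^`()^`()^`() * Q^`())
      + (2 * (x - 2)) *: (P^`()^`() * Q^`()^`()).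
  have := congr1 (@deriv _) apo1; rewrite !(derivZ, derivD, derivM) => H.
  rewrite -!mul_polyC in H *; apply: (lincomb1 (c1 := 1) H).
  by rewrite !(rmorphD, rmorphM, rmorphN, rmorph1, rmorph_nat) /=; ring.
have := congr1 (fun V => V.[t]) apo; have := congr1 (fun V => V.[t]) apo1.
have := congr1 (fun V => V.[t]) apo2.
by rewrite !(hornerD, hornerN, hornerZ, hornerM) Qt !(mulr0, addr0).
Qed.

(** * Rigidity of the extremal case *)

Section Rigidity.
Variables (A B : seq F) (d p : nat) (eps : F).
Let m := size A.
Let n := size B.
Let PA := root_poly A.
Let PB := root_poly B.
Let x : F := m%:R.
Let y : F := n%:R.
Hypotheses (uA : uniq A) (uB : uniq B) (m_ge2 : (2 <= m)%N) (n_ge2 : (2 <= n)%N).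
Hypotheses (dE : d = (m * n)%N) (ltdp : (2 * d < p)%N) (eps_neq0 : eps != 0).
Hypothesis natF : forall i, (0 < i < p)%N -> i%:R != 0 :> F.
Hypothesis diffAB : forall a b, a \in A -> b \in B -> (b - a) ^+ d = eps.
Hypothesis power_sums : forall k, (0 < k < d)%N ->
  \sum_(a <- A) \sum_(b <- B) (b - a) ^+ k = 0.
Hypothesis centered : \sum_(a <- A) a = 0.

Let d_ge4 : (4 <= d)%N.
Proof. by rewrite dE (leq_mul m_ge2 n_ge2). Qed.

Let ltmd : (m < d)%N.
Proof. by rewrite dE -{1}[m]muln1 ltn_pmul2l // ltnW. Qed.

Let ltnd : (n < d)%N.
Proof. by rewrite dE -{1}[n]mul1n ltn_pmul2r // ltnW. Qed.

Let lt_dp : (d.+1 < p)%N.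
Proof. by move: ltdp d_ge4; clear; lia. Qed.

Let natr_neq0 k : (0 < k <= d.+1)%N -> k%:R != 0 :> F.
Proof. by case/andP=> k0 kd; rewrite natF // k0 (leq_ltn_trans kd). Qed.

Let natr_inj i j : (i <= d)%N -> (j <= d)%N -> i%:R = j%:R :> F -> i = j.
Proof.
wlog ij : i j / (i <= j)%N => [IH id jd|_ jd].
  by have [/IH|/ltnW/IH H /esym/H->] := leqP i j => //; apply.
move=> /eqP; rewrite eq_sym -subr_eq0 -natrB // => ijF; apply/eqP.
rewrite eqn_leq ij leqNgt -subn_gt0; apply/negP => ji0.
have := natr_neq0 (k := j - i).
by rewrite ji0 leqW ?ijF ?(leq_trans (leq_subr _ _)) // => /(_ isT).
Qed.

Let x_neq0 : x != 0.
Proof. by rewrite natr_neq0 // (ltnW m_ge2) leqW // ltnW. Qed.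

Let y_neq0 : y != 0.
Proof. by rewrite natr_neq0 // (ltnW n_ge2) leqW // ltnW. Qed.

Let disjAB a : a \in A -> a \notin B.
Proof.
move=> Aa; apply/negP => /(diffAB Aa) epsE; move: eps_neq0.
by rewrite -epsE subrr expr0n (gtn_eqF (ltnW (ltnW (ltnW d_ge4)))) eqxx.
Qed.

Let uAB : uniq (A ++ B).
Proof.
rewrite cat_uniq uA uB andbT; apply/hasPn => b Bb.
by apply/negP => /disjAB; rewrite Bb.
Qed.

Let diffBA b a : b \in B -> a \in A -> (a - b) ^+ d = (-1) ^+ d * eps.
Proof. by move=> Bb Aa; rewrite -(opprB b a) [LHS]exprNn (diffAB Aa Bb). Qed.

Let dm1 : d.-1%:R = x * y - 1 :> F.
Proof. by rewrite -subn1 natrB ?dE ?natrM // -dE; lia. Qed.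

Let m1_neq0 : x + 1 != 0.
Proof. by rewrite natr1 natr_neq0 //= ltnW. Qed.

Let localB b : b \in B ->
  x * (x + 1) * (PA.[b] * PB^`()^`().[b]) =
    2 * (x * y - 1) * (PA^`().[b] * PB^`().[b]).
Proof.
move=> Bb; have ltdmp : (d + m <= p)%N by move: ltmd ltdp; clear; lia.
have [] := stepanov_local uA uB m_ge2 (ltnW n_ge2) (ltnW (ltnW (ltnW d_ge4)))
  eps_neq0 ltdmp natF diffAB Bb (ltnW d_ge4) dE.
by rewrite !natrM -[(size A).+1%:R]natr1 dm1.
Qed.

Let localA a : a \in A ->
  y * (y + 1) * (PB.[a] * PA^`()^`().[a]) =
    2 * (x * y - 1) * (PB^`().[a] * PA^`().[a]).
Proof.
move=> Aa; have ltdmp : (d + n <= p)%N by move: ltnd ltdp; clear; lia.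
have dE' : d = (size B * size A)%N by rewrite mulnC.
have eps'_neq0 : (-1) ^+ d * eps != 0 by rewrite mulf_neq0 // signr_eq0.
have [] := stepanov_local uB uA n_ge2 (ltnW m_ge2) (ltnW (ltnW (ltnW d_ge4)))
  eps'_neq0 ltdmp natF diffBA Aa (ltnW d_ge4) dE'.
by rewrite !natrM -[(size B).+1%:R]natr1 dm1.
Qed.

(** By [stepanov_local] for (A, B) and for (B, A), the difference of the two
sides vanishes at the m + n roots, and its degree is at most m + n - 2. *)
Lemma second_order_identity :
  (x * (x + 1)) *: (PA * PB^`()^`()) + (y * (y + 1)) *: (PA^`()^`() * PB)
  = (2 * (x * y - 1)) *: (PA^`() * PB^`()).
Proof.
have szA : (size PA <= m.+1)%N by rewrite size_root_poly.
have szB : (size PB <= n.+1)%N by rewrite size_root_poly.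
apply/eqP; rewrite -subr_eq0; apply/eqP; apply: (eq0_of_roots uAB).
- have szM i j : (0 < i + j)%N -> forall c, (size (c *: (PA^`(i) * PB^`(j))) <= m + n)%N.
    by move=> ij c; apply/(leq_trans (size_scale_leq _ _))/size_derivnM_le.
  by do !apply: size_polyD_le; rewrite ?size_polyN;
    [exact: (szM 0 2) | exact: (szM 2 0) | exact: (szM 1 1)].
- move=> a Aa; rewrite !(hornerD, hornerN, hornerZ, hornerM) (root_polyP Aa).
  apply: (lincomb1 (c1 := 1) (localA Aa)).
  by ring.
- move=> b Bb; rewrite !(hornerD, hornerN, hornerZ, hornerM) (root_polyP Bb).
  apply: (lincomb1 (c1 := 1) (localB Bb)).
  by ring.
Qed.

(** At the first index k where one of the two polynomials deviates from a pure
power, the power sums of A and B of exponent k are -k times the deviating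
coefficients.  The power sum of all the differences is zero and couples them,
so that both deviate at the same k.  Centering excludes k = 1. *)
Lemma common_gap : exists k, let al := PA`_(m - k) in let be := PB`_(n - k) in
  [/\ (2 <= k)%N, (k <= m)%N, (k <= n)%N,
    forall i, (0 < i < k)%N -> PA`_(m - i) = 0 &
    al != 0 /\ x * be = - ((-1) ^+ k * (y * al))].
Proof.
pose dev k := (0 < k)%N &&
  ((k <= m)%N && (PA`_(m - k) != 0) || (k <= n)%N && (PB`_(n - k) != 0)).
have [kA kAm PAk] := exists_lower_coef uA m_ge2.
have [kB kBn PBk] := exists_lower_coef uB n_ge2.
have devA : dev kA by move: kAm => /andP[k0 km]; rewrite /dev k0 km PAk.
have devB : dev kB by move: kBn => /andP[k0 km]; rewrite /dev k0 km PBk orbT.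
case: (ex_minnP (ex_intro _ kA devA)) => k /andP[k_gt0 devk] mink.
have lekm : (k <= m)%N by rewrite (leq_trans (mink _ devA)) //; case/andP: kAm.
have lekn : (k <= n)%N by rewrite (leq_trans (mink _ devB)) //; case/andP: kBn.
have gapA i : (0 < i < k)%N -> PA`_(m - i) = 0.
  move=> /andP[i0 ik]; have leik : (i <= m)%N by apply: leq_trans (ltnW ik) lekm.
  apply/eqP/negPn/negP => PAi; suff : (k <= i)%N by rewrite leqNgt ik.
  by apply: mink; rewrite /dev i0 leik PAi.
have gapB i : (0 < i < k)%N -> PB`_(n - i) = 0.
  move=> /andP[i0 ik]; have leik : (i <= n)%N by apply: leq_trans (ltnW ik) lekn.
  apply/eqP/negPn/negP => PBi; suff : (k <= i)%N by rewrite leqNgt ik.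
  by apply: mink; rewrite /dev i0 leik PBi orbT.
have sumA i : (0 < i <= k)%N -> \sum_(a <- A) a ^+ i = - (i%:R * PA`_(m - i)).
  case/andP=> i0 ik; apply: gap_power_sum; first by rewrite i0 (leq_trans ik).
  by move=> j /andP[j0 ji]; rewrite gapA // j0 (leq_trans ji).
have sumB : \sum_(b <- B) b ^+ k = - (k%:R * PB`_(n - k)).
  by apply: gap_power_sum => //; rewrite k_gt0.
have ltkd : (k < d)%N by apply: leq_ltn_trans ltmd.
have rel : x * PB`_(n - k) = - ((-1) ^+ k * (y * PA`_(m - k))).
  have k_neq0 : k%:R != 0 :> F by rewrite natr_neq0 // k_gt0 leqW // ltnW.
  have := power_sums (k := k); rewrite difference_power_sum //; last first.
    move=> i ik; rewrite sumA ?gapA ?mulr0 ?oppr0 //.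
    by case/andP: ik => -> /ltnW.
  rewrite sumA ?sumB ?k_gt0 ?leqnn // => /(_ ltkd) H.
  apply: (mulfI k_neq0); apply: (lincomb1 (c1 := -1) H).
  rewrite /x /y; move: ((-1) ^+ k) => e; ring.
have alk : PA`_(m - k) != 0.
  apply/eqP => al0; move: devk rel; rewrite al0 eqxx andbF lekn /= => bek.
  by rewrite !mulr0 oppr0 => /eqP; rewrite mulf_eq0 (negbTE x_neq0) (negbTE bek).
exists k; split => //; rewrite ltn_neqAle k_gt0 andbT; apply/eqP => k1.
have := sumA 1; rewrite -k1 => /(_ isT); under eq_bigr do rewrite expr1.
rewrite centered mul1r => /esym /eqP; rewrite oppr_eq0.
by move: alk; rewrite -k1 => /negbTE->.
Qed.

(** The coefficient of X^(m + n - k) in X^2 times the second order identity is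
a linear relation between the two deviating coefficients.  Together with the
relation from the power sums its determinant is, up to a unit,
(m + n + 2)(k - 1) for odd k and (k + 3)(m - n) for even k. *)
Lemma equal_sizes : m = n /\ exists k, let al := PA`_(m - k) in
  [/\ (0 < k <= m)%N, ~~ odd k,
    forall i, (0 < i < k)%N -> PA`_(m - i) = 0, al != 0 & PB`_(n - k) = - al].
Proof.
have [k [k_ge2 lekm lekn gap [al_neq0 rel]]] := common_gap.
have k0m : (0 < k <= m)%N by rewrite (ltnW k_ge2).
pose z : F := k%:R; set al := PA`_(m - k) in al_neq0 rel *.
have z_neq0 : z != 0 by rewrite natr_neq0 // (ltnW k_ge2) (leq_trans lekm) // leqW // ltnW.
have mk : (m - k)%:R = x - z :> F by rewrite natrB.
have nk : (n - k)%:R = y - z :> F by rewrite natrB.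
have coef_id :
    x * PB`_(n - k) * z * ((x + 1) * (z + 1) - 2 * (y + 1))
    + y * al * z * ((y + 1) * (z + 1) - 2 * (x + 1)) = 0.
  have := congr1 (fun V : {poly F} => ('X^2 * V)`_(m + n - k)) second_order_identity.
  rewrite /= (_ : 'X^2 * (_ + _) =
      (x * (x + 1)) *: (euler 0 PA * euler 2 PB)
      + (y * (y + 1)) *: (euler 2 PA * euler 0 PB)); last first.
    by rewrite /euler -!mul_polyC !derivnS !derivn0; ring.
  rewrite (_ : 'X^2 * _ = (2 * (x * y - 1)) *: (euler 1 PA * euler 1 PB)); last first.
    by rewrite /euler -!mul_polyC !derivnS !derivn0; ring.
  rewrite coefD !coefZ !(gap_coef_euler _ _ k0m lekn gap).
  rewrite !natr_ffact2 !ffactn0 !ffactn1 -/m -/n mk nk -/x -/y -/al => H.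
  by apply: (lincomb1 (c1 := 1) H); ring.
have dE2 : (m + n <= d)%N by rewrite dE; move: m_ge2 n_ge2; clear; nia.
have [odd_k|even_k] := boolP (odd k).
  rewrite -signr_odd odd_k expr1 mulN1r opprK in rel.
  have xy2 : x + y + 2 != 0.
    rewrite -!natrD natF //; move: dE2 ltdp d_ge4; clear; lia.
  have z1 : z - 1 != 0.
    rewrite -[1]/(1%:R) -natrB ?(ltnW k_ge2) // natr_neq0 //.
    by move: k_ge2 lekm ltmd; clear; lia.
  have nz : y * al * z * (x + y + 2) * (z - 1) != 0 by rewrite !mulf_neq0.
  case/eqP: nz; apply: (lincomb2 (c1 := 1)
    (c2 := - z * ((x + 1) * (z + 1) - 2 * (y + 1))) coef_id rel).
  by ring.
rewrite -signr_odd (negbTE even_k) expr0 mul1r in rel.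
have z3 : z + 3 != 0.
  by rewrite -natrD natr_neq0 //; move: lekm n_ge2 m_ge2 dE; clear; nia.
have nz : y * al * z * (z + 3) != 0 by rewrite !mulf_neq0.
have xy : x = y.
  apply: (mulfI nz); apply: (lincomb2 (c1 := -1)
    (c2 := z * ((x + 1) * (z + 1) - 2 * (y + 1))) coef_id rel).
  by ring.
split; first by apply: natr_inj xy; apply: ltnW.
exists k; split => //; apply: (mulfI x_neq0); rewrite rel -/al {1}xy; ring.
Qed.

Section EqualSizes.
Hypothesis mn : m = n.

Let yx : y = x.
Proof. by rewrite /y -mn. Qed.

Let dm2 : d.-2%:R = x ^+ 2 - 2 :> F.
Proof.
by rewrite -subn2 natrB ?(ltnW (ltnW d_ge4)) // dE natrM -/x -/y yx expr2.
Qed.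

Let xm1 : m.-1%:R = x - 1.
Proof. by rewrite -subn1 natrB // ltnW. Qed.

Let xp2 : m.+2%:R = x + 2.
Proof. by rewrite -addn2 natrD. Qed.

Let xm1_neq0 : x - 1 != 0.
Proof.
by rewrite -xm1 natr_neq0 //; move: m_ge2 ltmd; clear; lia.
Qed.

Let two_neq0 : (2 : F) != 0.
Proof. by rewrite (natr_neq0 (k := 2)) //= ltnW // ltnW // ltnW. Qed.

Let three_neq0 : (3 : F) != 0.
Proof. by rewrite (natr_neq0 (k := 3)) //= ltnW // ltnW. Qed.

Lemma apolar :
  x *: (PA * PB^`()^`() + PA^`()^`() * PB) = (2 * (x - 1)) *: (PA^`() * PB^`()).
Proof.
apply: (scalerI m1_neq0); have := second_order_identity; rewrite yx => H.
rewrite -!mul_polyC in H *; apply: (lincomb1 (c1 := 1) H).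
by rewrite !(rmorphD, rmorphM, rmorphN, rmorph1, rmorph_nat) /=; ring.
Qed.

Let B1_neq0 b : b \in B -> PB^`().[b] != 0.
Proof.
move=> Bb; rewrite deriv_root_poly horner_sum (bigD1_seq b) //= big1_seq ?addr0.
  by rewrite root_poly_neq0 // mem_rem_uniqF.
move=> a /andP[ab Ba]; apply: root_polyP.
by rewrite mem_rem_uniq // inE /= eq_sym ab.
Qed.

Let A1_neq0 a : a \in A -> PA^`().[a] != 0.
Proof.
move=> Aa; rewrite deriv_root_poly horner_sum (bigD1_seq a) //= big1_seq ?addr0.
  by rewrite root_poly_neq0 // mem_rem_uniqF.
move=> b /andP[ba Ab]; apply: root_polyP.
by rewrite mem_rem_uniq // inE /= eq_sym ba.
Qed.

Let A0_neq0 b : b \in B -> PA.[b] != 0.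
Proof. by move=> Bb; apply: root_poly_neq0; apply/negP => /disjAB; rewrite Bb. Qed.

Let B0_neq0 a : a \in A -> PB.[a] != 0.
Proof. by move=> Aa; apply: root_poly_neq0; apply: disjAB. Qed.

Let apolarC :
  x *: (PB * PA^`()^`() + PB^`()^`() * PA) = (2 * (x - 1)) *: (PB^`() * PA^`()).
Proof.
by rewrite [PB * _]mulrC [_ * PA]mulrC addrC apolar [PA^`() * _]mulrC.
Qed.

Let ratioB b : b \in B ->
  x * ratio_poly x * (PA.[b] * PA^`()^`().[b]) =
    (x - 1) * (ratio_poly x + 3 * x) * PA^`().[b] ^+ 2.
Proof.
move=> Bb; have ltdmp : (d + m <= p)%N by move: ltmd ltdp; clear; lia.
have [_ L2] := stepanov_local uA uB m_ge2 (ltnW n_ge2) (ltnW (ltnW (ltnW d_ge4)))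
  eps_neq0 ltdmp natF diffAB Bb (ltnW d_ge4) dE.
have [S S' _] := apolar_local apolar (root_polyP Bb).
apply: (ratio_at (B1_neq0 Bb) two_neq0 S S' m1_neq0).
rewrite !natrM -/m dm1 dm2 xm1 xp2 -[m.+1%:R]natr1 -/x yx in L2.
by apply: (lincomb1 (c1 := 1) L2); ring.
Qed.

Let ratioA a : a \in A ->
  x * ratio_poly x * (PB.[a] * PB^`()^`().[a]) =
    (x - 1) * (ratio_poly x + 3 * x) * PB^`().[a] ^+ 2.
Proof.
move=> Aa; have ltdmp : (d + n <= p)%N by move: ltnd ltdp; clear; lia.
have dE' : d = (size B * size A)%N by rewrite mulnC.
have eps'_neq0 : (-1) ^+ d * eps != 0 by rewrite mulf_neq0 // signr_eq0.
have [_ L2] := stepanov_local uB uA n_ge2 (ltnW m_ge2) (ltnW (ltnW (ltnW d_ge4)))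
  eps'_neq0 ltdmp natF diffBA Aa (ltnW d_ge4) dE'.
have [S S' _] := apolar_local apolarC (root_polyP Aa).
apply: (ratio_at (A1_neq0 Aa) two_neq0 S S' m1_neq0).
rewrite !natrM -/n -mn dm1 dm2 xm1 xp2 -[m.+1%:R]natr1 -/x yx in L2.
by apply: (lincomb1 (c1 := 1) L2); ring.
Qed.

Let evals := (hornerD, hornerN, hornerZ, hornerM).

Let szM i j : (0 < i + j)%N -> forall c : F, (size (c *: (PA^`(i) * PB^`(j))) <= m + n)%N.
Proof.
move=> ij c; apply/(leq_trans (size_scale_leq _ _))/size_derivnM_le => //.
  by rewrite size_root_poly.
by rewrite size_root_poly.
Qed.

(** The combination is antisymmetric under the exchange of A and B, so one
computation at a root serves for both sets. *)
Let third_order_identity :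
  coefAB3 x *: (PA * PB^`()^`()^`()) + (- coefAB3 x) *: (PA^`()^`()^`() * PB)
  + (coefA1B2 x *: (PA^`() * PB^`()^`()) + (- coefA1B2 x) *: (PA^`()^`() * PB^`())) = 0.
Proof.
apply: (eq0_of_roots uAB).
- by do !apply: size_polyD_le;
    [exact: (@szM 0 3) | exact: (@szM 3 0) | exact: (@szM 1 2) | exact: (@szM 2 1)].
- move=> a Aa; rewrite !evals (root_polyP Aa).
  have [S S' _] := apolar_local apolarC (root_polyP Aa).
  have := third_order_at x_neq0 (B0_neq0 Aa) S S' (ratioA Aa).
  by move=> H; apply: (lincomb1 (c1 := -1) H); ring.
- move=> b Bb; rewrite !evals (root_polyP Bb).
  have [S S' _] := apolar_local apolar (root_polyP Bb).
  have := third_order_at x_neq0 (A0_neq0 Bb) S S' (ratioB Bb).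
  by move=> H; apply: (lincomb1 (c1 := 1) H); ring.
Qed.

Let deriv_third_order :
  coefAB3 x *: (PA * PB^`()^`()^`()^`()) + (- coefAB3 x) *: (PA^`()^`()^`()^`() * PB)
  + ((coefAB3 x + coefA1B2 x) *: (PA^`() * PB^`()^`()^`())
      + (- (coefAB3 x + coefA1B2 x)) *: (PA^`()^`()^`() * PB^`())) = 0.
Proof.
have := congr1 (@deriv _) third_order_identity.
rewrite deriv0 !(derivZ, derivD, derivM) => H.
rewrite -!mul_polyC in H *; apply: (lincomb1 (c1 := 1) H).
by rewrite !(rmorphD, rmorphN); ring.
Qed.

(** If it were zero, P' would vanish at the n = m roots of Q, although its
degree is m - 1. *)
Let ratio_poly_neq0 : ratio_poly x != 0.
Proof.
apply/eqP => X0; have B_gt0 : (0 < size B)%N := ltnW n_ge2.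
have dPA0 : PA^`() = 0.
  apply: (@roots_geq_poly_eq0 _ _ B) => //.
    apply/allP => b /ratioB; rewrite X0 mulr0 mul0r add0r => /esym/eqP.
    have nz : (x - 1) * (3 * x) != 0 by rewrite !mulf_neq0.
    by rewrite mulf_eq0 (negbTE nz) expf_eq0.
  by rewrite -/n -mn (leq_trans (size_derivn_le PA 1)) // size_root_poly subn1.
have /eqP := congr1 (fun V : {poly F} => V`_m.-1) dPA0.
by rewrite coef_deriv coef0 prednK ?(ltnW m_ge2) // root_poly_lead (negbTE x_neq0).
Qed.

Let fourth_order_identity :
  coefA1B3 x *: (PA^`() * PB^`()^`()^`()) + coefA1B3 x *: (PA^`()^`()^`() * PB^`())
  + coefA2B2 x *: (PA^`()^`() * PB^`()^`()) = 0.
Proof.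
apply: (eq0_of_roots uAB).
- by do !apply: size_polyD_le;
    [exact: (@szM 1 3) | exact: (@szM 3 1) | exact: (@szM 2 2)].
- move=> a Aa; rewrite !evals.
  have [S S' S''] := apolar_local apolarC (root_polyP Aa).
  have := congr1 (fun V => V.[a]) deriv_third_order.
  rewrite !evals (root_polyP Aa) horner0 => V'.
  have := fourth_order_at x_neq0 (B0_neq0 Aa) two_neq0 S S' (ratioA Aa) ratio_poly_neq0 S''.
  move=> H; apply: (lincomb1 (c1 := 1) (H _)); last by ring.
  by apply: (lincomb1 (c1 := -1) V'); ring.
- move=> b Bb; rewrite !evals.
  have [S S' S''] := apolar_local apolar (root_polyP Bb).
  have := congr1 (fun V => V.[b]) deriv_third_order.
  rewrite !evals (root_polyP Bb) horner0 => V'.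
  have := fourth_order_at x_neq0 (A0_neq0 Bb) two_neq0 S S' (ratioB Bb) ratio_poly_neq0 S''.
  move=> H; apply: (lincomb1 (c1 := 1) (H _)); last by ring.
  by apply: (lincomb1 (c1 := 1) V'); ring.
Qed.

(** The fourth order form has degree at most 2 m - 4, and [fourth_order_lead]
gives its coefficient at that degree. *)
Let two_or_exceptional : x = 2 \/ exceptional_poly x = 0.
Proof.
have := congr1 (fun V : {poly F} => ('X^4 * V)`_(m + n)) fourth_order_identity.
rewrite mulr0 coef0 /= (_ : 'X^4 * _ =
   coefA1B3 x *: (euler 1 PA * euler 3 PB) + coefA1B3 x *: (euler 3 PA * euler 1 PB)
   + coefA2B2 x *: (euler 2 PA * euler 2 PB)); last first.
  by rewrite /euler -!mul_polyC !derivnS !derivn0; ring.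
rewrite !coefD !coefZ !top_coef_euler ffactn1 !natr_ffact2 !natr_ffact3 -/m -/n -/x.
rewrite -/y yx ffactn1 -/n -/y yx => H.
have : - 12 * x ^+ 3 * (x - 1) ^+ 2 * (x - 2) * exceptional_poly x = 0.
  by rewrite -fourth_order_lead; apply: (lincomb1 (c1 := 1) H); ring.
have nz : - 12 * x ^+ 3 * (x - 1) ^+ 2 != 0.
  rewrite !mulf_neq0 ?expf_neq0 // oppr_eq0 (_ : 12 = 2 * 2 * 3 :> F); last by ring.
  by rewrite !mulf_neq0.
rewrite -mulrA => /eqP; rewrite mulf_eq0 (negbTE nz) mulf_eq0 /=.
by rewrite subr_eq0 => /orP[] /eqP; [left|right].
Qed.

(** When [exceptional_poly] vanishes at m, the third order identity reduces to
P' Q'' = P'' Q'.  Its coefficient at the gap k is a unit times k - m, so k = m,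
which is even by [equal_sizes]. *)
Lemma size2_or_even : m = 2 \/ ~~ odd m /\ exceptional_poly x = 0.
Proof.
have [x2|C0] := two_or_exceptional.
  by left; apply: natr_inj x2; [apply: ltnW | apply: ltnW (ltnW d_ge4)].
right; split => //; have [_ [k [km even_k gap al_neq0 be]]] := equal_sizes.
suff <- : k = m by [].
have /andP[k0 lekm] := km; have lekn : (k <= n)%N by rewrite -mn.
have := congr1 (fun V : {poly F} => ('X^3 * V)`_(m + n - k)) third_order_identity.
have c10 : coefAB3 x = 0 by rewrite /coefAB3 C0 mulr0.
rewrite mulr0 coef0 /= c10 oppr0 !scale0r !add0r (_ : 'X^3 * _ =
   coefA1B2 x *: (euler 1 PA * euler 2 PB)
   + (- coefA1B2 x) *: (euler 2 PA * euler 1 PB)); last first.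
  by rewrite /euler -!mul_polyC !derivnS !derivn0; ring.
rewrite !coefD !coefZ !(gap_coef_euler _ _ km lekn gap) be -/m -/n -mn.
rewrite !ffactn1 !natr_ffact2 natrB // -/x => H.
set al := PA`_(m - k) in al_neq0 H.
have c2E : coefA1B2 x = 3 * 2 * 2 * x by rewrite /coefA1B2 C0; ring.
have nz : 3 * 2 ^+ 3 * x ^+ 2 * k%:R * al != 0.
  by rewrite !mulf_neq0 ?expf_neq0 // natr_neq0 // k0 (leq_trans lekm) // leqW // ltnW.
apply: (@natr_inj k m); [exact: leq_trans (ltnW ltmd) | exact: ltnW |].
apply: (mulfI nz); apply: (lincomb1 (c1 := -1) H); rewrite c2E; ring.
Qed.
End EqualSizes.
End Rigidity.
End Decomposition.

(** * Subgroups of a prime field *)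

(** Since 3 m^2 + 4 m - 1 < 2 (2 m^2 + 1) for m >= 4, the quotient by p is 1.
Then p - 1 = m (3 m + 4) - 2, so m divides 2. *)
Lemma exceptional_prime p m : (4 <= m)%N -> (m %| p.-1)%N -> (2 * m ^ 2 < p)%N ->
  (p %| 3 * m ^ 2 + 4 * m - 1)%N -> False.
Proof.
move=> m_ge4 m_dvd ltmp /dvdnP[q qE].
have q1 : q = 1 by nia.
have sumE : (p.-1 + 2 = m * (3 * m + 4))%N by rewrite q1 in qE; nia.
have : (m %| 2)%N by rewrite -(dvdn_addr _ m_dvd) sumE dvdn_mulr.
by move/(dvdn_leq (isT : 0 < 2)); rewrite leqNgt; move: m_ge4; clear; lia.
Qed.

Section PrimeField.
Local Open Scope ring_scope.
Variables (p : nat) (H : {group {unit 'F_p}}).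
Hypothesis p_prime : prime p.

Lemma card_unit_set : #|unit_set H| = #|H|.
Proof. by rewrite card_imset //; apply: val_inj. Qed.

Lemma unit_set_exp h : h \in unit_set H -> h ^+ #|H| = 1.
Proof.
case/imsetP=> u Hu ->; rewrite -FinRing.val_unitX.
by rewrite expg_cardG // FinRing.val_unit1.
Qed.

Lemma Fp_natr_neq0 i : (0 < i < p)%N -> i%:R != 0 :> 'F_p.
Proof.
by case/andP=> i0 ip; rewrite -(dvdn_pcharf (pchar_Fp p_prime)) gtnNdvd.
Qed.

Lemma card_units_dvd : (#|H| %| p.-1)%N.
Proof.
by have := cardSg (subsetT H); rewrite card_finField_unit card_Fp.
Qed.

(** Multiplication by g permutes H and multiplies the sum by g^k.  Some g has
g^k != 1, because X^k - 1 has at most k roots. *)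
Lemma unit_set_power_sum k : (0 < k < #|H|)%N -> \sum_(h in unit_set H) h ^+ k = 0.
Proof.
move=> /andP[k0 kd]; set S := unit_set H.
have [g Sg gk] : exists2 g, g \in H & (val g) ^+ k != 1.
  apply/exists_inP; apply: contraT => /exists_inPn allk.
  have : (#|S| < size ('X^k - 1 : {poly 'F_p})%R)%N.
    rewrite cardE; apply: max_poly_roots; rewrite ?enum_uniq //.
      by rewrite -size_poly_eq0 size_XnsubC.
    apply/allP => h; rewrite mem_enum => /imsetP[u Hu ->].
    by rewrite /root !hornerE subr_eq0; apply/negPn/allk.
  by rewrite size_XnsubC // card_unit_set ltnS leqNgt kd.
have sumM : \sum_(h in S) h ^+ k = (val g) ^+ k * \sum_(h in S) h ^+ k.
  rewrite !big_imset /=; try by move=> ? ? _ _; apply: val_inj.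
  rewrite [LHS](reindex_inj (mulgI g)) mulr_sumr /=.
  apply: eq_big => [u|u Hu]; first by rewrite groupMl.
  by rewrite -exprMn.
apply/eqP; move/eqP: sumM; rewrite -subr_eq0 -{1}[X in X - _]mul1r -mulrBl mulf_eq0.
by rewrite subr_eq0 eq_sym (negbTE gk).
Qed.

Lemma size_proper_subgroup : H \proper [set: {unit 'F_p}] -> (2 * #|H| < p)%N.
Proof.
move/proper_card; rewrite card_finField_unit card_Fp // => ltHp.
case/dvdnP: card_units_dvd ltHp => q qE; rewrite qE => ltHq.
have H_gt0 := cardG_gt0 H.
apply: (@leq_ltn_trans p.-1); last by rewrite ltn_predL prime_gt0.
by rewrite qE leq_mul2r -(ltn_pmul2r H_gt0) mul1n ltHq orbT.
Qed.
End PrimeField.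

Theorem theorem1p1 (p : nat) (p_prime : prime p) (p_odd : odd p)
    (H : {group {unit 'F_p}}) (H_proper : H \proper [set: {unit 'F_p}])
    (A B : {set 'F_p}) (A_ge2 : 2 <= #|A|) (B_ge2 : 2 <= #|B|)
    (H_sum : unit_set H = sumset A B) :
  [/\ #|A| = 2, #|B| = 2 & #|H| = 4].
Proof.
have ltHp := size_proper_subgroup p_prime H_proper.
have natF := Fp_natr_neq0 p_prime.
have cardS : #|sumset A B| = #|H| by rewrite -H_sum card_unit_set.
have sum_exp a b : a \in A -> b \in B -> ((a + b) ^+ #|H| = 1)%R.
  by move=> Aa Bb; apply: unit_set_exp; rewrite H_sum imset2_f.
have leAH : #|A| <= #|H|.
  have /card_gt0P[b Bb] : 0 < #|B| by apply: ltnW.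
  rewrite -cardS -(card_imset (mem A) (addIr b)); apply/subset_leq_card/subsetP.
  by move=> _ /imsetP[a Aa ->]; rewrite imset2_f.
(* This shift makes the sum of As zero; it exists since |A| is invertible mod p. *)
pose t : 'F_p := ((\sum_(a in A) a) / #|A|%:R)%R.
pose As := [seq (t - a)%R | a <- enum A]; pose Bs := [seq (b + t)%R | b <- enum B].
have uAs : uniq As by rewrite map_inj_uniq ?enum_uniq //; apply: subrI.
have uBs : uniq Bs by rewrite map_inj_uniq ?enum_uniq //; apply: addIr.
have szAs : size As = #|A| by rewrite size_map -cardE.
have szBs : size Bs = #|B| by rewrite size_map -cardE.
have diff a b : a \in As -> b \in Bs -> ((b - a) ^+ #|H| = 1)%R.
  case/mapP=> a' + -> /mapP[b' + ->]; rewrite !mem_enum => Aa Bb.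
  by rewrite -(sum_exp a' b') //; congr (_ ^+ _)%R; ring.
have leMH : #|A| * #|B| <= #|H|.
  rewrite -szAs -szBs; apply: (stepanov_bound uAs uBs _ _ _ (oner_neq0 _) _ natF diff).
  - by rewrite szAs.
  - by rewrite szBs ltnW.
  - exact: cardG_gt0.
  - by rewrite szAs; move: leAH ltHp; clear; lia.
have sumE : sumset A B = [set uncurry +%R u | u in setX A B] by apply: curry_imset2X.
(* The bound is attained, so the sums a + b are distinct and run over H once. *)
have cardH : #|H| = #|A| * #|B|.
  by apply/eqP; rewrite eqn_leq leMH andbT -cardS sumE -cardsX leq_imset_card.
have inj_sum : {in setX A B &, injective (uncurry +%R)}.
  by apply/imset_injP; rewrite -sumE cardS cardH cardsX.
have power k : 0 < k < #|H| -> (\sum_(a <- As) \sum_(b <- Bs) (b - a) ^+ k = 0)%R.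
  move=> /unit_set_power_sum; rewrite H_sum sumE big_imset //=.
  move=> sum0; rewrite -[RHS]sum0; transitivity (\sum_(a in A) \sum_(b in B) (a + b) ^+ k)%R.
    rewrite big_map big_enum; apply: eq_bigr => a _.
    by rewrite big_map big_enum; apply: eq_bigr => b _; congr (_ ^+ _)%R; ring.
  by rewrite pair_big /=; apply: eq_big => -[a b] //=; rewrite in_setX.
have cA : (#|A|%:R != 0 :> 'F_p)%R.
  rewrite natF // (ltnW A_ge2) (leq_ltn_trans leAH) // (leq_ltn_trans _ ltHp) //.
  by rewrite leq_pmull.
have centered : (\sum_(a <- As) a = 0)%R.
  by rewrite big_map big_enum /= sumrB sumr_const -mulr_natr /t divfK ?subrr.
rewrite -szAs in A_ge2; rewrite -szBs in B_ge2.
rewrite -szAs -szBs in cardH.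
have [mn _] :=
  equal_sizes uAs uBs A_ge2 B_ge2 cardH ltHp (oner_neq0 _) natF diff power centered.
have := size2_or_even
  uAs uBs A_ge2 B_ge2 cardH ltHp (oner_neq0 _) natF diff power centered mn.
have [m2 _|m_neq2 [/eqP|[even_m C0]]] := eqVneq (size As) 2.
- by rewrite cardH -szAs -szBs -mn m2.
- by rewrite (negbTE m_neq2).
rewrite -mn in cardH.
exfalso; apply: (@exceptional_prime p (size As)).
- by move: A_ge2 even_m m_neq2; clear; case: (size As) => [|[|[|[|]]]].
- by apply: dvdn_trans (card_units_dvd H p_prime); rewrite cardH dvdn_mulr.
- by rewrite -mulnn -cardH.
- rewrite (dvdn_pcharf (pchar_Fp p_prime)) -C0 /exceptional_poly natrB; last first.
    by rewrite addn_gt0 (muln_gt0 4) (ltnW A_ge2) orbT.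
  by rewrite natrD !natrM; apply/eqP; ring.
Qed.
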